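(* For all $\beta>\beta_c=\log4$, there exists a critical value $K_c^{(1)}(\beta)$ satisfying $K_1(\beta)<K_c^{(1)}(\beta)<K_2(\beta)$ and having the following properties. (a) For $0<K<K_c^{(1)}(\beta)$, $\tilde{\mathcal{E}}_{\beta,K}=\{0\}$. (b) For $K=K_c^{(1)}(\beta)$, $\tilde{\mathcal{E}}_{\beta,K}=\{0,\pm\tilde z(\beta,K)\}$, where $\tilde z(\beta,K)>0$. (c) For $K>K_c^{(1)}(\beta)$, $\tilde{\mathcal{E}}_{\beta,K}=\{\pm\tilde z(\beta,K)\}$, where $\tilde z(\beta,K)>0$. (d) For $K\ge K_c^{(1)}(\beta)$, $\tilde z(\beta,K)$ is a strictly increasing continuous function of $K$, and $\tilde z(\beta,K)\to\tilde z(\beta,K_c^{(1)}(\beta))>0$ as $K\to(K_c^{(1)}(\beta))^+$. (In this sense $\tilde{\mathcal{E}}_{\beta,K}$ exhibits a discontinuous bifurcation at $K_c^{(1)}(\beta)$.)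
   Context: Let $\Lambda=\{-1,0,1\}$, $\rho=\frac13(\delta_{-1}+\delta_0+\delta_1)$ and, for $\beta>0$, $\rho_\beta(dy)=\frac{1}{Z(\beta)}e^{-\beta y^2}\rho(dy)$ with $Z(\beta)=\int_\Lambda e^{-\beta y^2}\rho(dy)$. Define $$c_\beta(t)=\log\int_\Lambda e^{ty}\rho_\beta(dy)=\log\Big[\frac{1+e^{-\beta}(e^t+e^{-t})}{1+2e^{-\beta}}\Big],\qquad J_\beta(z)=\sup_{t\in\mathbb{R}}\{tz-c_\beta(t)\}.$$ For $\beta>0,K>0$ the set of canonical equilibrium macrostates for the spin per site is $$\tilde{\mathcal{E}}_{\beta,K}=\{z\in[-1,1]: z\text{ minimizes }J_\beta(z)-\beta Kz^2\text{ over }[-1,1]\};$$ equivalently, with $F_{\beta,K}(w)=\frac{w^2}{4\beta K}-c_\beta(w)$ for $w\in\mathbb{R}$, $$\tilde{\mathcal{E}}_{\beta,K}=\Big\{\frac{w}{2\beta K}\in\mathbb{R}: w\text{ minimizes }F_{\beta,K}(w)\text{ over }\mathbb{R}\Big\}.$$ For $\beta>\log 4$: $K_1(\beta)$ is the unique $K>0$ for which the line $w\mapsto w/(2\beta K)$ is tangent to the curve $w\mapsto c_\beta'(w)$ at some point $w_1(\beta)>0$; that is, $(w_1(\beta),K_1(\beta))$ is the unique solution in $\{w>0,K>0\}$ of $\frac{w}{2\beta K}=c_\beta'(w)$, $\frac1{2\beta K}=c_\beta''(w)$. Also $K_2(\beta)=\frac{1}{2\beta c_\beta''(0)}=\frac1{4\beta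 e^{-\beta}}+\frac1{2\beta}$. *)

(* Defs.v *)
From Stdlib Require Import Reals Lra.
From Coquelicot Require Import Coquelicot.
Open Scope R_scope.

Definition int_rho (f : R -> R) : R := / 3 * (f (-1) + f 0 + f 1).

Definition Z (beta : R) : R := int_rho (fun y => exp (- beta * y ^ 2)).

Definition int_rho_beta (beta : R) (f : R -> R) : R :=
  int_rho (fun y => / Z beta * exp (- beta * y ^ 2) * f y).

Definition c (beta t : R) : R :=
  ln (int_rho_beta beta (fun y => exp (t * y))).

(* The supremum is [p_infty] for z outside [-1,1]. *)
Definition J (beta z : R) : Rbar :=
  Lub_Rbar (fun u : R => exists t : R, u = t * z - c beta t).

Definition G (beta K z : R) : Rbar :=
  Rbar_minus (J beta z) (beta * K * z ^ 2).

Definition macrostates (beta K z : R) : Prop :=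
  -1 <= z <= 1 /\
  forall x : R, -1 <= x <= 1 -> Rbar_le (G beta K z) (G beta K x).

(* The line w |-> w / (2 beta K) is tangent to the graph of c_beta' at w > 0. *)
Definition tangent_at (beta K w : R) : Prop :=
  0 < w /\ 0 < K /\
  w / (2 * beta * K) = Derive (c beta) w /\
  1 / (2 * beta * K) = Derive_n (c beta) 2 w.

(* Definite description: the value is meaningful only when exactly one K
   satisfies the predicate, which is the case for beta > ln 4. *)
Definition K1 (beta : R) : R :=
  iota (fun K : R => exists w : R, tangent_at beta K w).

Definition K2 (beta : R) : R := 1 / (2 * beta * Derive_n (c beta) 2 0).

Lemma c_explicit (beta t : R) :
  c beta t =
  ln ((1 + exp (- beta) * (exp t + exp (- t))) / (1 + 2 * exp (- beta))).
Proof.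
pose proof (exp_pos (- beta)) as He.
unfold c, int_rho_beta, Z, int_rho; f_equal.
replace (- beta * (-1) ^ 2) with (- beta) by ring.
replace (- beta * 0 ^ 2) with 0 by ring.
replace (- beta * 1 ^ 2) with (- beta) by ring.
replace (t * -1) with (- t) by ring.
replace (t * 0) with 0 by ring.
rewrite Rmult_1_r, exp_0; field; lra.
Qed.

Lemma Derive_c (beta t : R) :
  Derive (c beta) t =
  exp (- beta) * (exp t - exp (- t)) /
  (1 + exp (- beta) * (exp t + exp (- t))).
Proof.
pose proof (exp_pos (- beta)) as He.
pose proof (exp_pos t) as H1; pose proof (exp_pos (- t)) as H2.
assert (Hp : 0 < exp (- beta) * (exp t + exp (- t)))
  by (apply Rmult_lt_0_compat; lra).
rewrite (Derive_ext _ _ _ (c_explicit beta)).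
apply is_derive_unique; auto_derive.
- apply Rdiv_lt_0_compat; lra.
- field; lra.
Qed.

Lemma K2_explicit (beta : R) : 0 < beta ->
  K2 beta = 1 / (4 * beta * exp (- beta)) + 1 / (2 * beta).
Proof.
intros Hb; pose proof (exp_pos (- beta)) as He.
assert (H : Derive_n (c beta) 2 0 =
            2 * exp (- beta) / (1 + 2 * exp (- beta))).
{ change (Derive (Derive (c beta)) 0 =
          2 * exp (- beta) / (1 + 2 * exp (- beta))).
  rewrite (Derive_ext _ _ _ (Derive_c beta)).
  apply is_derive_unique; auto_derive; rewrite ?Ropp_0, ?exp_0.
  - lra.
  - field; lra. }
unfold K2; rewrite H; field; lra.
Qed.

(* Main.v *)
(* By convexity of c_beta, G(x) >= F(2 beta K x), with equality at critical
   points of F, so the macrostates are the rescaled minimizers of F. For w > 0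
   the sign of F'(w) is that of phi(w) - 2 beta K with phi(w) = w / c_beta'(w).
   For beta > log 4, phi decreases on (0, w1) and increases on (w1, oo), hence F
   can only be minimal at 0 or at +-T, where T >= w1 solves phi(T) = 2 beta K.
   There F(T) = T c_beta'(T) / 2 - c_beta(T), which as a function of T increases
   from 0 up to w1 and then decreases, with a unique zero q > w1; the critical
   value is phi(q) / (2 beta), and z = c_beta'(T). *)
Require Import Defs.
From Stdlib Require Import Reals Lra Ranalysis5.
From Coquelicot Require Import Coquelicot.
Open Scope R_scope.

(** * Monotonicity and sign changes from derivatives *)

Lemma is_derive_increasing (f df : R -> R) (x y : R) :
  x < y ->
  (forall t, x <= t <= y -> is_derive f t (df t)) ->
  (forall t, x < t < y -> 0 < df t) ->
  f x < f y.
Proof.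
intros Hxy Hd Hp.
destruct (MVT_cor2 f df x y Hxy) as [t [Et Ht]].
- intros t Ht; apply is_derive_Reals; auto.
- assert (0 < df t * (y - x)) by (apply Rmult_lt_0_compat; [auto | lra]); lra.
Qed.

Lemma is_derive_decreasing (f df : R -> R) (x y : R) :
  x < y ->
  (forall t, x <= t <= y -> is_derive f t (df t)) ->
  (forall t, x < t < y -> df t < 0) ->
  f y < f x.
Proof.
intros Hxy Hd Hp.
cut (- f x < - f y); [lra|].
apply (is_derive_increasing (fun t => - f t) (fun t => - df t)); auto.
- intros t Ht; apply (is_derive_opp f); auto.
- intros t Ht; specialize (Hp t Ht); lra.
Qed.

Lemma is_derive_continuity_pt (f : R -> R) (x l : R) :
  is_derive f x l -> continuity_pt f x.
Proof.
intros H; apply derivable_continuous_pt; exists l; now apply is_derive_Reals.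
Qed.

(** The values at 0 and at [p] are left open: most functions of interest vanish at 0. *)
Definition neg_then_pos (f : R -> R) (p : R) : Prop :=
  0 < p /\ (forall t, 0 < t < p -> f t < 0) /\ (forall t, p < t -> 0 < f t).

(** From a nonpositive start [f] falls up to [p] and then rises, so one positive value at [b] forces
    exactly one crossing. Applied repeatedly, this carries a sign pattern through successive
    integrations. *)
Lemma neg_then_pos_primitive (f df : R -> R) (p b : R) :
  (forall t, is_derive f t (df t)) ->
  neg_then_pos df p -> f 0 <= 0 -> 0 < b -> 0 < f b ->
  exists q, p < q /\ neg_then_pos f q /\ f q = 0.
Proof.
intros Hd (Hp & Hn & Hpos) H0 Hb Hfb.
assert (Hdec : forall t, 0 < t <= p -> f t < 0).
{ intros t Ht; apply Rlt_le_trans with (f 0); auto.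
  apply (is_derive_decreasing f df); [lra | auto |].
  intros s Hs; apply Hn; lra. }
assert (Hinc : forall s t, p <= s < t -> f s < f t).
{ intros s t Hst; apply (is_derive_increasing f df); [lra | auto |].
  intros u Hu; apply Hpos; lra. }
assert (Hpb : p < b).
{ destruct (Rlt_le_dec p b) as [|Hle]; auto.
  specialize (Hdec b (conj Hb Hle)); lra. }
destruct (IVT_interv f p b) as [q [Hq Eq]]; auto.
- intros t _; apply (is_derive_continuity_pt f t (df t)); auto.
- apply Hdec; lra.
- assert (p <> q) by (intros ->; specialize (Hdec q); lra).
  exists q; repeat split; auto; [lra | lra | |].
  + intros t Ht; destruct (Rle_lt_dec t p); [apply Hdec; lra|].
    rewrite <- Eq; apply Hinc; lra.
  + intros t Ht; rewrite <- Eq; apply Hinc; lra.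
Qed.

Lemma is_derive_zero_at_min (f : R -> R) (w l : R) :
  is_derive f w l -> (forall y, f w <= f y) -> l = 0.
Proof.
intros Hd Hm.
assert (pr : derivable_pt f w) by (exists l; now apply is_derive_Reals).
rewrite <- (deriv_minimum f (w - 1) (w + 1) w pr); [| lra | lra | auto].
symmetry; apply derive_pt_eq_0; now apply is_derive_Reals.
Qed.

Lemma is_derive_pos_right (f : R -> R) (x l : R) :
  is_derive f x l -> 0 < l ->
  exists d, 0 < d /\ forall t, x < t < x + d -> f x < f t.
Proof.
intros Hd Hl; apply is_derive_Reals in Hd.
destruct (Hd l Hl) as [d Hd']; exists d; split; [apply cond_pos|].
intros t Ht; specialize (Hd' (t - x)).
replace (x + (t - x)) with t in Hd' by ring.
assert (H : Rabs ((f t - f x) / (t - x) - l) < l).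
{ apply Hd'; [lra|]; rewrite Rabs_pos_eq; lra. }
apply Rabs_def2 in H.
assert (E : f t - f x = (f t - f x) / (t - x) * (t - x)) by (field; lra).
assert (0 < (f t - f x) / (t - x) * (t - x)) by (apply Rmult_lt_0_compat; lra).
lra.
Qed.

(** * Hyperbolic functions and the sign of [N] *)

Lemma sinh_pos (t : R) : 0 < t -> 0 < sinh t.
Proof.
intros Ht; unfold sinh; assert (exp (- t) < exp t) by (apply exp_increasing; lra).
lra.
Qed.

Lemma cosh_pos (t : R) : 0 < cosh t.
Proof.
unfold cosh; pose proof (exp_pos t); pose proof (exp_pos (- t)); lra.
Qed.

Lemma cosh_sqr (t : R) : cosh t * cosh t = 1 + sinh t * sinh t.
Proof.
unfold cosh, sinh; rewrite exp_Ropp; pose proof (exp_pos t); field; lra.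
Qed.

(** Squaring exp(t/2) >= 1 + t/2 produces a quadratic term, which beats linear terms in t at
    explicit points. *)
Lemma sinh_quadratic_lower (t : R) : 0 < t -> t + t * t / 4 <= 2 * sinh t.
Proof.
intros Ht.
assert (E : exp t = exp (t / 2) * exp (t / 2)) by (rewrite <- exp_plus; f_equal; field).
pose proof (exp_ineq1_le (t / 2)).
assert (H1 : (1 + t / 2) * (1 + t / 2) <= exp t)
  by (rewrite E; apply Rmult_le_compat; lra).
assert (exp (- t) < exp 0) by (apply exp_increasing; lra).
rewrite exp_0 in *; unfold sinh; lra.
Qed.

(* [N a] is the numerator of [c' - t c''], where [a = exp (- beta)]. *)
Definition N (a t : R) : R :=
  sinh t * (1 + 2 * a * cosh t) - t * (cosh t + 2 * a).

(** Here N' = sinh t (4a sinh t - t), and the second factor has derivative 4a cosh t - 1, which is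
    increasing for t > 0 and negative at 0 because a < 1/4, that is, beta > log 4. Two integrations
    transfer the sign pattern to [N a]. *)
Lemma neg_then_pos_N (a : R) : 0 < a < 1 / 4 ->
  exists q, neg_then_pos (N a) q /\ N a q = 0.
Proof.
intros Ha.
assert (Hia : 0 < / a) by (apply Rinv_0_lt_compat; lra).
assert (Hu : exists p, neg_then_pos (fun t => 4 * a * cosh t - 1) p).
{ assert (Hc : forall s t, 0 <= s < t -> cosh s < cosh t).
  { intros s t Hst; apply (is_derive_increasing cosh sinh); [lra | |].
    - intros u _; apply is_derive_Reals, derivable_pt_lim_cosh.
    - intros u Hu; apply sinh_pos; lra. }
  (* The right endpoint comes from exp x >= 1 + x: at x = 1/(2a), 2a exp x >= 2a + 1 > 1. *)
  destruct (IVT_interv (fun t => 4 * a * cosh t - 1) 0 (1 / (2 * a)))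
    as [p [Hp Ep]].
  - intros t _; apply (is_derive_continuity_pt _ _ (4 * a * sinh t)).
    unfold cosh, sinh; auto_derive; auto; field.
  - apply Rdiv_lt_0_compat; lra.
  - rewrite cosh_0; lra.
  - pose proof (exp_ineq1_le (1 / (2 * a))).
    pose proof (exp_pos (- (1 / (2 * a)))).
    assert (2 * a * (1 + 1 / (2 * a)) <= 2 * a * exp (1 / (2 * a)))
      by (apply Rmult_le_compat_l; lra).
    assert (0 < 2 * a * exp (- (1 / (2 * a)))) by (apply Rmult_lt_0_compat; lra).
    replace (2 * a * (1 + 1 / (2 * a))) with (2 * a + 1) in * by (field; lra).
    unfold cosh; lra.
  - exists p; unfold neg_then_pos.
    assert (Hp0 : p <> 0) by (intros ->; rewrite cosh_0 in Ep; lra).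
    split; [lra|]; split; intros t Ht.
    + assert (4 * a * cosh t < 4 * a * cosh p)
        by (apply Rmult_lt_compat_l; [lra|]; apply Hc; lra); lra.
    + assert (4 * a * cosh p < 4 * a * cosh t)
        by (apply Rmult_lt_compat_l; [lra|]; apply Hc; lra); lra. }
destruct Hu as [p Hp].
(* At t = 4/a the quadratic bound gives 4a sinh t >= 8 + 8/a > t. *)
destruct (neg_then_pos_primitive (fun t => 4 * a * sinh t - t)
            (fun t => 4 * a * cosh t - 1) p (4 / a)) as [p' (_ & Hp' & _)]; auto.
- intros t; unfold cosh, sinh; auto_derive; auto; field.
- rewrite sinh_0; lra.
- apply Rdiv_lt_0_compat; lra.
- assert (H4 : 0 < 4 / a) by (apply Rdiv_lt_0_compat; lra).
  pose proof (sinh_quadratic_lower _ H4) as Hs.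
  assert (H : 2 * a * (4 / a + 4 / a * (4 / a) / 4) <= 2 * a * (2 * sinh (4 / a)))
    by (apply Rmult_le_compat_l; lra).
  replace (2 * a * (4 / a + 4 / a * (4 / a) / 4)) with (8 + 8 / a) in H by (field; lra).
  unfold Rdiv in *; lra.
- destruct (neg_then_pos_primitive (N a) (fun t => sinh t * (4 * a * sinh t - t)) p' (4 / a))
    as [q (_ & Hq)]; [.. | now exists q].
  + intros t.
    (* This is N' as the product rule yields it; the last summand is zero by [cosh_sqr] and makes
       [ring] succeed. *)
    replace (sinh t * (4 * a * sinh t - t)) with
      (cosh t * (1 + 2 * a * cosh t) + sinh t * (2 * a * sinh t)
       - (cosh t + 2 * a) - t * sinh t
       - 2 * a * (cosh t * cosh t - (1 + sinh t * sinh t))) by ring.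
    rewrite cosh_sqr, Rminus_diag, Rmult_0_r.
    unfold N, cosh, sinh; auto_derive; auto; field.
  + destruct Hp' as (H1 & H2 & H3); split; [auto|split]; intros t Ht.
    * assert (0 < sinh t) by (apply sinh_pos; lra); specialize (H2 t Ht); nra.
    * apply Rmult_lt_0_compat; [apply sinh_pos; lra | auto].
  + unfold N; rewrite sinh_0; lra.
  + apply Rdiv_lt_0_compat; lra.
  + assert (H4 : 0 < 4 / a) by (apply Rdiv_lt_0_compat; lra).
    pose proof (sinh_quadratic_lower _ H4) as Hs.
    pose proof (cosh_pos (4 / a)).
    assert (Hq : a * (4 / a + 4 / a * (4 / a) / 4) <= a * (2 * sinh (4 / a)))
      by (apply Rmult_le_compat_l; lra).
    replace (a * (4 / a + 4 / a * (4 / a) / 4)) with (4 + 4 / a) in Hq by (field; lra).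
    (* Regroup N as sinh t + cosh t (2a sinh t - t) - 2at at t = 4/a: the middle term is positive,
       and sinh t >= t/2 exceeds 2at since a < 1/4. *)
    assert (0 < cosh (4 / a) * (2 * a * sinh (4 / a) - 4 / a))
      by (apply Rmult_lt_0_compat; lra).
    assert (0 < 4 / a * (1 / 2 - 2 * a)) by (apply Rmult_lt_0_compat; lra).
    assert (0 <= 4 / a * (4 / a) / 4) by (apply Rmult_le_pos; [apply Rmult_le_pos|]; lra).
    unfold N; lra.
Qed.

(** * Closed forms of c' and c'', convexity and growth of c *)

Definition dc (beta t : R) : R :=
  2 * exp (- beta) * sinh t / (1 + 2 * exp (- beta) * cosh t).

Definition ddc (beta t : R) : R :=
  2 * exp (- beta) * (cosh t + 2 * exp (- beta)) /
  (1 + 2 * exp (- beta) * cosh t) ^ 2.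

Lemma dc_denominator_pos (beta t : R) : 0 < 1 + 2 * exp (- beta) * cosh t.
Proof.
pose proof (exp_pos (- beta)); pose proof (cosh_pos t).
assert (0 < exp (- beta) * cosh t) by (apply Rmult_lt_0_compat; lra); lra.
Qed.

Lemma is_derive_c (beta t : R) : is_derive (c beta) t (dc beta t).
Proof.
apply (is_derive_ext (fun t => ln ((1 + 2 * exp (- beta) * cosh t) / (1 + 2 * exp (- beta))))).
- intros u; rewrite c_explicit; do 2 f_equal; unfold cosh; field.
- pose proof (dc_denominator_pos beta t) as H; pose proof (exp_pos (- beta)).
  unfold dc, sinh; unfold cosh in *; auto_derive.
  + apply Rdiv_lt_0_compat; lra.
  + field; lra.
Qed.

Lemma is_derive_dc (beta t : R) : is_derive (dc beta) t (ddc beta t).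
Proof.
pose proof (dc_denominator_pos beta t) as H.
replace (ddc beta t) with
  ((2 * exp (- beta) * cosh t * (1 + 2 * exp (- beta) * cosh t)
    - 2 * exp (- beta) * sinh t * (2 * exp (- beta) * sinh t))
   / (1 + 2 * exp (- beta) * cosh t) ^ 2).
- unfold dc; unfold cosh, sinh in *; auto_derive; [lra | field; lra].
- unfold ddc; f_equal.
  transitivity (2 * exp (- beta) * cosh t + 4 * exp (- beta) * exp (- beta)
     * (cosh t * cosh t - sinh t * sinh t)); [ring|].
  rewrite cosh_sqr; ring.
Qed.

Lemma ddc_pos (beta t : R) : 0 < ddc beta t.
Proof.
pose proof (exp_pos (- beta)); pose proof (cosh_pos t).
unfold ddc; apply Rdiv_lt_0_compat.
- apply Rmult_lt_0_compat; lra.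
- apply pow_lt, dc_denominator_pos.
Qed.

Lemma dc_pos (beta t : R) : 0 < t -> 0 < dc beta t.
Proof.
intros Ht; pose proof (exp_pos (- beta)); pose proof (sinh_pos t Ht).
apply Rdiv_lt_0_compat; [apply Rmult_lt_0_compat; lra | apply dc_denominator_pos].
Qed.

Lemma dc_0 (beta : R) : dc beta 0 = 0.
Proof. unfold dc; rewrite sinh_0; unfold Rdiv; ring. Qed.

(** It places every point c'(w) in [-1,1], and its strict upper bound yields phi(t) > t. *)
Lemma dc_bounded (beta t : R) : -1 <= dc beta t < 1.
Proof.
pose proof (dc_denominator_pos beta t) as H; pose proof (exp_pos (- beta)) as Ha.
assert (0 < exp (- beta) * exp t) by (apply Rmult_lt_0_compat; auto using exp_pos).
assert (0 < exp (- beta) * exp (- t)) by (apply Rmult_lt_0_compat; auto using exp_pos).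
unfold dc; split.
- apply Rle_div_r; auto; unfold cosh, sinh; lra.
- apply Rlt_div_l; auto; unfold cosh, sinh; lra.
Qed.

Lemma c_opp (beta t : R) : c beta (- t) = c beta t.
Proof. rewrite !c_explicit, Ropp_involutive, (Rplus_comm (exp (- t))); reflexivity. Qed.

Lemma c_0 (beta : R) : c beta 0 = 0.
Proof.
pose proof (exp_pos (- beta)); rewrite c_explicit, Ropp_0, exp_0, <- ln_1.
f_equal; field; lra.
Qed.

(** Only the term exp(-beta) exp(t) of the numerator is kept. The slope 1 eventually beats t c'(t)/2
    < t/2. *)
Lemma c_lower (beta t : R) : t - ln ((1 + 2 * exp (- beta)) / exp (- beta)) < c beta t.
Proof.
pose proof (exp_pos (- beta)); pose proof (exp_pos t); pose proof (exp_pos (- t)).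
rewrite c_explicit, ln_div by lra.
rewrite ln_div by (repeat (try apply Rplus_lt_0_compat; try apply Rmult_lt_0_compat); lra).
rewrite <- (ln_exp t) at 1.
assert (ln (exp (- beta)) + ln (exp t) < ln (1 + exp (- beta) * (exp t + exp (- t)))).
{ rewrite <- ln_mult by auto; apply ln_increasing; [apply Rmult_lt_0_compat; auto|].
  assert (0 < exp (- beta) * exp (- t)) by (apply Rmult_lt_0_compat; auto); lra. }
lra.
Qed.

(** Convexity, from c'' > 0 and the mean value theorem; it identifies where the supremum [J] is
    attained. *)
Lemma c_tangent (beta t w : R) : c beta w + dc beta w * (t - w) <= c beta t.
Proof.
assert (Hinc : forall x y, x < y -> dc beta x < dc beta y).
{ intros x y Hxy; apply (is_derive_increasing (dc beta) (ddc beta)); auto.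
  - intros u _; apply is_derive_dc.
  - intros u _; apply ddc_pos. }
assert (Hm : forall x y, x < y -> exists u, c beta y - c beta x = dc beta u * (y - x) /\ x < u < y).
{ intros x y Hxy; apply MVT_cor2; auto.
  intros u _; apply is_derive_Reals, is_derive_c. }
destruct (Rtotal_order t w) as [H|[->|H]].
- destruct (Hm t w H) as [u [Eu Hu]]; pose proof (Hinc u w (proj2 Hu)); nra.
- lra.
- destruct (Hm w t H) as [u [Eu Hu]]; pose proof (Hinc w u (proj1 Hu)); nra.
Qed.

Lemma dc_sub_mul_ddc (beta t : R) :
  dc beta t - t * ddc beta t =
  2 * exp (- beta) / (1 + 2 * exp (- beta) * cosh t) ^ 2 * N (exp (- beta)) t.
Proof.
pose proof (dc_denominator_pos beta t); unfold dc, ddc, N; field; lra.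
Qed.

Lemma neg_then_pos_dc_sub (beta w1 : R) :
  neg_then_pos (N (exp (- beta))) w1 ->
  neg_then_pos (fun t => dc beta t - t * ddc beta t) w1.
Proof.
intros (H1 & H2 & H3).
assert (H : forall t, 0 < 2 * exp (- beta) / (1 + 2 * exp (- beta) * cosh t) ^ 2).
{ intros t; pose proof (exp_pos (- beta)).
  apply Rdiv_lt_0_compat; [lra | apply pow_lt, dc_denominator_pos]. }
split; [auto | split]; intros t Ht; rewrite dc_sub_mul_ddc; specialize (H t).
- specialize (H2 t Ht); nra.
- specialize (H3 t Ht); nra.
Qed.

(** * The ratio phi: its monotonicity and its limit at 0 *)

Definition phi (beta t : R) : R := t / dc beta t.

Lemma is_derive_phi (beta t : R) : 0 < t ->
  is_derive (phi beta) t ((dc beta t - t * ddc beta t) / dc beta t ^ 2).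
Proof.
intros Ht; pose proof (dc_pos beta t Ht).
replace (dc beta t - t * ddc beta t) with (1 * dc beta t - t * ddc beta t) by ring.
apply is_derive_div; [apply (is_derive_id t) | apply is_derive_dc | lra].
Qed.

Lemma phi_gt (beta t : R) : 0 < t -> t < phi beta t.
Proof.
intros Ht; pose proof (dc_pos beta t Ht); pose proof (dc_bounded beta t).
apply Rlt_div_r; [auto|]; nra.
Qed.

Lemma phi_decreasing (beta w1 s t : R) :
  neg_then_pos (N (exp (- beta))) w1 -> 0 < s < t -> t <= w1 ->
  phi beta t < phi beta s.
Proof.
intros Hw Hst Ht; destruct (neg_then_pos_dc_sub _ _ Hw) as (_ & Hn & _).
apply (is_derive_decreasing _ (fun t => (dc beta t - t * ddc beta t) / dc beta t ^ 2));
  [lra | |].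
- intros u Hu; apply is_derive_phi; lra.
- intros u Hu; assert (0 < dc beta u) by (apply dc_pos; lra).
  apply Rlt_div_l; [now apply pow_lt|]; rewrite Rmult_0_l; apply Hn; lra.
Qed.

Lemma phi_increasing (beta w1 s t : R) :
  neg_then_pos (N (exp (- beta))) w1 -> w1 <= s < t ->
  phi beta s < phi beta t.
Proof.
intros Hw Hst; destruct (neg_then_pos_dc_sub _ _ Hw) as (H0 & _ & Hp).
apply (is_derive_increasing _ (fun t => (dc beta t - t * ddc beta t) / dc beta t ^ 2));
  [lra | |].
- intros u Hu; apply is_derive_phi; lra.
- intros u Hu; assert (0 < dc beta u) by (apply dc_pos; lra).
  apply Rdiv_lt_0_compat; [apply Hp; lra | now apply pow_lt].
Qed.

(* [1 / ddc beta 0] is the limit of [phi beta] at [0]. *)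
Lemma phi_lt_limit_0 (beta w1 t : R) :
  neg_then_pos (N (exp (- beta))) w1 -> 0 < t <= w1 ->
  phi beta t < 1 / ddc beta 0.
Proof.
intros Hw Ht; apply Rnot_le_lt; intros Hle.
pose proof (ddc_pos beta 0) as Hd0.
(* Passing to t/2 gains strictness: m = phi(t/2) exceeds 1/c''(0), so c'(s) - s/m has positive
   derivative at 0. Then phi(s) < m for some s < t/2, against the decrease of phi on (0, w1]. *)
pose proof (phi_decreasing beta w1 (t / 2) t Hw ltac:(lra) ltac:(lra)) as Hm.
set (m := phi beta (t / 2)) in *.
assert (H0 : 0 < 1 / ddc beta 0) by (apply Rdiv_lt_0_compat; lra).
destruct (is_derive_pos_right (fun s => dc beta s - s / m) 0 (ddc beta 0 - / m))
  as [d [Hd Hs]].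
- apply (is_derive_minus (dc beta) (fun s => s / m)); [apply is_derive_dc|].
  auto_derive; auto; field; lra.
- assert (/ m < / (1 / ddc beta 0)) by (apply Rinv_lt_contravar; [apply Rmult_lt_0_compat|]; lra).
  replace (/ (1 / ddc beta 0)) with (ddc beta 0) in * by (field; lra); lra.
- pose proof (Rmin_l d (t / 2)); pose proof (Rmin_r d (t / 2)).
  assert (0 < Rmin d (t / 2)) by (apply Rmin_glb_lt; lra).
  set (s := Rmin d (t / 2) / 2); assert (Hs0 : 0 < s) by (unfold s; lra).
  assert (Hsd : dc beta 0 - 0 / m < dc beta s - s / m) by (apply Hs; unfold s; lra).
  pose proof (phi_decreasing beta w1 s (t / 2) Hw ltac:(unfold s; lra) ltac:(lra)) as Hsm.
  fold m in Hsm; pose proof (dc_pos beta s Hs0).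
  rewrite dc_0 in Hsd; unfold Rdiv in Hsd at 1; rewrite Rmult_0_l in Hsd.
  assert (Hlt : s / m < dc beta s) by lra.
  apply (Rlt_div_l s (dc beta s) m) in Hlt; [|lra].
  apply (Rlt_div_r m s (dc beta s)) in Hsm; lra.
Qed.

(** * The landscape of F and its critical levels *)

(* The paper's F_{beta,K}, with k = 2 beta K. *)
Definition F (beta k w : R) : R := w ^ 2 / (2 * k) - c beta w.

Lemma is_derive_F (beta k w : R) : 0 < k -> is_derive (F beta k) w (w / k - dc beta w).
Proof.
intros Hk; unfold F; auto_derive.
- exists (dc beta w); apply is_derive_c.
- replace (Derive (fun x => c beta x) w) with (dc beta w)
      by (symmetry; apply is_derive_unique, is_derive_c); field; lra.
Qed.

Lemma F_opp (beta k w : R) : F beta k (- w) = F beta k w.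
Proof. unfold F; rewrite c_opp; f_equal; f_equal; ring. Qed.

Lemma F_0 (beta k : R) : F beta k 0 = 0.
Proof. unfold F; rewrite c_0; unfold Rdiv; ring. Qed.

Lemma F_increasing (beta k s t : R) : 0 < k -> 0 <= s < t ->
  (forall u, s < u < t -> k < phi beta u) -> F beta k s < F beta k t.
Proof.
intros Hk Hst H; apply (is_derive_increasing _ (fun w => w / k - dc beta w)); [lra | |].
- intros u _; now apply is_derive_F.
- intros u Hu; specialize (H u Hu).
  apply <- Rlt_div_r in H; [|apply dc_pos; lra].
  assert (dc beta u < u / k) by (apply -> Rlt_div_r; lra); lra.
Qed.

Lemma F_decreasing (beta k s t : R) : 0 < k -> 0 <= s < t ->
  (forall u, s < u < t -> phi beta u < k) -> F beta k t < F beta k s.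
Proof.
intros Hk Hst H; apply (is_derive_decreasing _ (fun w => w / k - dc beta w)); [lra | |].
- intros u _; now apply is_derive_F.
- intros u Hu; specialize (H u Hu).
  apply -> Rlt_div_l in H; [|apply dc_pos; lra].
  assert (u / k < dc beta u) by (apply <- Rlt_div_l; lra); lra.
Qed.

(** By evenness take w > 0. Beyond T, F increases. If w < T and phi(w) <= k, then phi < k on (w, T)
    and F decreases down to T. If phi(w) > k, then w < w1 and phi > k on (0, w), so F has increased
    from F(0) = 0. *)
Lemma F_min_cases (beta w1 k T w : R) :
  neg_then_pos (N (exp (- beta))) w1 -> w1 <= T -> phi beta T = k ->
  w <> 0 -> w <> T -> w <> - T ->
  F beta k T < F beta k w \/ 0 < F beta k w.
Proof.
intros Hw HT Ek.
assert (Hk : 0 < k) by (destruct Hw; pose proof (phi_gt beta T); lra).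
assert (Hpos : forall w, 0 < w -> w <> T -> F beta k T < F beta k w \/ 0 < F beta k w).
{ intros v Hv HvT; destruct Hw as [Hw1 Hw'].
  assert (Hw : neg_then_pos (N (exp (- beta))) w1) by now split.
  destruct (Rlt_le_dec T v) as [HTv|HTv].
  - left; apply F_increasing; [auto | lra |].
    intros u Hu; rewrite <- Ek; apply (phi_increasing beta w1); auto; lra.
  - destruct (Rle_lt_dec (phi beta v) k) as [Hle|Hlt].
    + left; apply F_decreasing; [auto | lra |].
      intros u Hu; destruct (Rle_lt_dec u w1).
      * apply Rlt_le_trans with (phi beta v); auto.
        apply (phi_decreasing beta w1); auto; lra.
      * rewrite <- Ek; apply (phi_increasing beta w1); auto; lra.
    + right; rewrite <- (F_0 beta k); apply F_increasing; [auto | lra |].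
      assert (v < w1).
      { apply Rnot_le_lt; intros Hle.
        pose proof (phi_increasing beta w1 v T Hw); lra. }
      intros u Hu; apply Rlt_trans with (phi beta v); auto.
      apply (phi_decreasing beta w1); auto; lra. }
intros H0 H1 H2; destruct (Rlt_le_dec 0 w); [apply Hpos; lra|].
rewrite <- (F_opp beta k w); apply Hpos; lra.
Qed.

Lemma F_critical (beta t : R) : 0 < t ->
  F beta (phi beta t) t = t * dc beta t / 2 - c beta t.
Proof.
intros Ht; pose proof (dc_pos beta t Ht); unfold F, phi; field; lra.
Qed.

(** The derivative of c - t c'/2 is (c' - t c'')/2, whose sign is that of N. Past q, the critical
    level of F drops below F(0) = 0. *)
Lemma F_critical_zero (beta w1 : R) :
  neg_then_pos (N (exp (- beta))) w1 ->
  exists q, w1 < q /\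
    neg_then_pos (fun t => c beta t - t * dc beta t / 2) q /\
    c beta q - q * dc beta q / 2 = 0.
Proof.
intros Hw; apply neg_then_pos_dc_sub in Hw.
set (l := ln ((1 + 2 * exp (- beta)) / exp (- beta))).
assert (Hl : 0 < l).
{ pose proof (exp_pos (- beta)); unfold l; rewrite <- ln_1; apply ln_increasing; [lra|].
  apply Rlt_div_r; lra. }
(* At t = 2l, [c_lower] gives c(t) > l, while t c'(t)/2 = l c'(t) < l. *)
apply (neg_then_pos_primitive (fun t => c beta t - t * dc beta t / 2)
         (fun t => (dc beta t - t * ddc beta t) / 2) w1 (2 * l)).
- intros t; auto_derive.
  + repeat split; eexists; [apply is_derive_c | apply is_derive_dc].
  + replace (Derive (fun x => c beta x) t) with (dc beta t)
      by (symmetry; apply is_derive_unique, is_derive_c).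
    replace (Derive (fun x => dc beta x) t) with (ddc beta t)
      by (symmetry; apply is_derive_unique, is_derive_dc); field.
- destruct Hw as (H1 & H2 & H3); split; [auto | split]; intros t Ht.
  + specialize (H2 t Ht); lra.
  + specialize (H3 t Ht); lra.
- rewrite c_0; lra.
- lra.
- pose proof (c_lower beta (2 * l)); fold l in H; pose proof (dc_bounded beta (2 * l)); nra.
Qed.

Lemma phi_surjective (beta s k : R) :
  0 < s -> phi beta s <= k -> exists t, s <= t /\ phi beta t = k.
Proof.
intros Hs [Hlt|<-]; [|exists s; lra].
pose proof (phi_gt beta s Hs); pose proof (phi_gt beta k).
(* The value k itself serves as right endpoint, since phi(k) > k. *)
destruct (IVT_interv (fun t => phi beta t - k) s k) as [t [Ht Et]]; try lra.
- intros t Ht; eapply is_derive_continuity_pt; apply (is_derive_minus (phi beta) (fun _ => k)).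
  + apply is_derive_phi; lra.
  + apply is_derive_const.
- exists t; lra.
Qed.

(** * Duality between G and F *)

Lemma is_lub_J (beta z : R) :
  is_lub_Rbar (fun u : R => exists t : R, u = t * z - c beta t) (J beta z).
Proof. apply Lub_Rbar_correct. Qed.

(** The choice t = 2 beta K x in the supremum defining [J] gives exactly F on the left. *)
Lemma G_ge_F (beta K x : R) : 0 < beta -> 0 < K ->
  Rbar_le (F beta (2 * beta * K) (2 * beta * K * x)) (G beta K x).
Proof.
intros Hb HK.
destruct (is_lub_J beta x) as [Hub _].
specialize (Hub (2 * beta * K * x * x - c beta (2 * beta * K * x)) (ex_intro _ _ eq_refl)).
assert (E : F beta (2 * beta * K) (2 * beta * K * x) =
  2 * beta * K * x * x - c beta (2 * beta * K * x) - beta * K * x ^ 2)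
  by (unfold F; field; lra).
rewrite E; unfold G; destruct (J beta x); simpl in *; auto; lra.
Qed.

(** When x = c'(w), the tangent line inequality shows that the supremum is attained at t = w. *)
Lemma G_eq_F (beta K x : R) : 0 < beta -> 0 < K ->
  dc beta (2 * beta * K * x) = x ->
  G beta K x = F beta (2 * beta * K) (2 * beta * K * x).
Proof.
intros Hb HK Hx; set (w := 2 * beta * K * x) in *.
assert (E : J beta x = w * x - c beta w).
{ apply is_lub_Rbar_unique; split.
  - intros u [t ->]; simpl; pose proof (c_tangent beta t w); rewrite Hx in *; nra.
  - intros b Hb'; apply Hb'; now exists w. }
unfold G; rewrite E; simpl; f_equal; unfold F, w; field; lra.
Qed.

(** A minimizer kx of F is critical, so c'(kx) = x and G = F there, which makes x a macrostate.
    Conversely a macrostate x satisfies F(kx) <= G(x) <= G(w0/k) = F(w0). *)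
Lemma macrostates_iff_F_min (beta K w0 : R) : 0 < beta -> 0 < K ->
  (forall w, F beta (2 * beta * K) w0 <= F beta (2 * beta * K) w) ->
  forall x, macrostates beta K x <->
    F beta (2 * beta * K) (2 * beta * K * x) <= F beta (2 * beta * K) w0.
Proof.
intros Hb HK Hmin.
assert (Hk : 0 < 2 * beta * K) by (repeat apply Rmult_lt_0_compat; lra).
set (k := 2 * beta * K) in *.
assert (Hcrit : forall x, F beta k (k * x) <= F beta k w0 -> dc beta (k * x) = x).
{ intros x Hx.
  assert (H : k * x / k - dc beta (k * x) = 0).
  { apply (is_derive_zero_at_min (F beta k) (k * x)); [now apply is_derive_F|].
    intros y; apply Rle_trans with (1 := Hx); auto. }
  replace (k * x / k) with x in H by (field; lra); lra. }
intros x; split.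
- intros [_ H].
  (* The competitor x0 is admissible: criticality makes it a value of c', hence a point of
     [-1,1]. *)
  set (x0 := w0 / k); assert (E0 : k * x0 = w0) by (unfold x0; field; lra).
  assert (Hc0 : dc beta (k * x0) = x0) by (apply Hcrit; rewrite E0; lra).
  assert (Hx0 : -1 <= x0 <= 1) by (pose proof (dc_bounded beta (k * x0)); lra).
  specialize (H x0 Hx0); rewrite (G_eq_F beta K x0) in H; auto; fold k in H.
  rewrite E0 in H.
  apply (Rbar_le_trans (F beta k (k * x)) (G beta K x) (F beta k w0)); auto.
  now apply G_ge_F.
- intros Hx; pose proof (Hcrit x Hx) as Hc; split.
  + pose proof (dc_bounded beta (k * x)); lra.
  + intros y _; rewrite (G_eq_F beta K x); auto; fold k.
    apply (Rbar_le_trans _ (F beta k (k * y))); [|now apply G_ge_F].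
    simpl; apply Rle_trans with (1 := Hx); auto.
Qed.

(** * The tangency value [K1], and continuity of a monotone inverse *)

Lemma Derive_n_c_2 (beta t : R) : Derive_n (c beta) 2 t = ddc beta t.
Proof.
change (Derive (Derive (c beta)) t = ddc beta t).
rewrite (Derive_ext _ (dc beta)); [apply is_derive_unique, is_derive_dc|].
intros u; apply is_derive_unique, is_derive_c.
Qed.

(** Eliminating K from the two tangency equations leaves c'(w) = w c''(w), whose only positive root
    is w1; this uniqueness gives the description [K1] its value. *)
Lemma K1_eq (beta w1 : R) : 0 < beta ->
  neg_then_pos (N (exp (- beta))) w1 -> N (exp (- beta)) w1 = 0 ->
  K1 beta = phi beta w1 / (2 * beta).
Proof.
intros Hb Hw Hw0; pose proof (neg_then_pos_dc_sub _ _ Hw) as (H0 & Hn & Hp).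
assert (Ht : forall K w, tangent_at beta K w <->
  0 < w /\ K = phi beta w / (2 * beta) /\ dc beta w - w * ddc beta w = 0).
{ intros K w; unfold tangent_at; rewrite Derive_n_c_2.
  rewrite (is_derive_unique _ _ _ (is_derive_c beta w)).
  split.
  - intros (Hw' & HK & E1 & E2); split; [auto|].
    rewrite <- E1, <- E2; unfold phi; rewrite <- E1.
    split; field; lra.
  - intros (Hw' & -> & E); pose proof (dc_pos beta w Hw').
    assert (E' : ddc beta w = dc beta w / w) by (apply Rmult_eq_reg_l with w; [|lra]; field_simplify; lra).
    split; [auto|]; split; [|split].
    + apply Rdiv_lt_0_compat; [apply Rdiv_lt_0_compat|]; lra.
    + unfold phi; field; lra.
    + rewrite E'; unfold phi; field; lra. }
apply (iota_unique (V := R_CompleteNormedModule)).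
- intros K [w Hw']; apply Ht in Hw' as (Hwp & -> & E).
  destruct (Rtotal_order w w1) as [H|[->|H]]; auto.
  + specialize (Hn w (conj Hwp H)); lra.
  + specialize (Hp w H); lra.
- exists w1; apply Ht; split; [auto | split; [auto|]].
  rewrite dc_sub_mul_ddc, Hw0; ring.
Qed.

(** If y lies between g(T y0 - eps) and g(T y0 + eps), monotonicity of g traps T y within eps of T
    y0. *)
Lemma continuous_on_right_inverse (g T : R -> R) (a b : R) :
  (forall s t, a <= s -> s < t -> g s < g t) ->
  (forall y, b <= y -> a <= T y /\ g (T y) = y) ->
  continuous_on (fun y => b <= y) T.
Proof.
intros Hg HT y0 Hy0; apply filterlim_locally; intros eps.
destruct (HT y0 Hy0) as [Ha E0]; pose proof (cond_pos eps) as He.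
assert (Hlow : exists d : posreal, forall y, b <= y -> y0 - d < y -> T y0 - eps < T y).
{ destruct (Rle_lt_dec a (T y0 - eps)) as [Hle|Hlt].
  - pose proof (Hg (T y0 - eps) (T y0) Hle ltac:(lra)) as H.
    assert (Hd : 0 < y0 - g (T y0 - eps)) by lra.
    exists (mkposreal _ Hd); intros y Hy; simpl; intros Hy'.
    destruct (HT y Hy) as [Hay Ey]; apply Rnot_le_lt; intros [H'| H'].
    + pose proof (Hg _ _ Hay H'); lra.
    + rewrite H' in Ey; lra.
  (* If T y0 - eps < a, the lower bound follows from T y >= a, and any radius will do. *)
  - exists eps; intros y Hy _; destruct (HT y Hy); lra. }
destruct Hlow as [d1 H1].
pose proof (Hg (T y0) (T y0 + eps) Ha ltac:(lra)) as H2.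
assert (Hd2 : 0 < g (T y0 + eps) - y0) by lra.
exists (mkposreal _ (Rmin_stable_in_posreal d1 (mkposreal _ Hd2))).
intros y Hball Hy; apply Rabs_def2 in Hball; simpl in Hball.
pose proof (Rmin_l d1 (g (T y0 + eps) - y0)); pose proof (Rmin_r d1 (g (T y0 + eps) - y0)).
unfold minus, plus, opp in Hball; simpl in Hball.
assert (T y0 - eps < T y) by (apply H1; lra).
assert (T y < T y0 + eps).
{ destruct (HT y Hy) as [Hay Ey]; apply Rnot_le_lt; intros [H'| H'].
  - pose proof (Hg (T y0 + eps) (T y) ltac:(lra) H'); lra.
  - rewrite <- H' in Ey; lra. }
apply Rabs_def1; unfold minus, plus, opp; simpl; lra.
Qed.

(** * The critical value [Kc] and the discontinuous bifurcation *)

Theorem theorem3p8 :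
  forall beta : R, ln 4 < beta ->
  exists Kc : R,
    K1 beta < Kc < K2 beta /\
    (forall K : R, 0 < K < Kc ->
       forall x : R, macrostates beta K x <-> x = 0) /\
    exists z : R -> R,
      (0 < z Kc /\
       forall x : R, macrostates beta Kc x <-> x = 0 \/ x = z Kc \/ x = - z Kc) /\
      (forall K : R, Kc < K ->
         0 < z K /\
         forall x : R, macrostates beta K x <-> x = z K \/ x = - z K) /\
      (forall K K' : R, Kc <= K -> K < K' -> z K < z K') /\
      continuous_on (fun K : R => Kc <= K) z /\
      filterlim z (at_right Kc) (locally (z Kc)).
Proof.
intros beta Hbeta.
assert (Hb : 0 < beta).
{ assert (ln 1 < ln 4) by (apply ln_increasing; lra); rewrite ln_1 in *; lra. }
assert (Ha : 0 < exp (- beta) < 1 / 4).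
{ split; [apply exp_pos|].
  replace (1 / 4) with (exp (- ln 4)); [apply exp_increasing; lra|].
  rewrite exp_Ropp, exp_ln; lra. }
destruct (neg_then_pos_N _ Ha) as [w1 [Hw HN0]].
assert (Hw1 : 0 < w1) by apply Hw.
destruct (F_critical_zero beta w1 Hw) as [q (Hq & (_ & _ & Eq_pos) & Eq0)].
set (Kc := phi beta q / (2 * beta)).
pose proof (phi_gt beta q ltac:(lra)) as Hphiq.
assert (HKc : 0 < Kc) by (apply Rdiv_lt_0_compat; lra).
assert (EKc : 2 * beta * Kc = phi beta q) by (unfold Kc; field; lra).
assert (HFq : F beta (phi beta q) q = 0) by (rewrite F_critical; lra).
(* At k = phi(q) the wells at q and -q have the same height 0 as the origin, and every other point
   is strictly higher. *)
assert (HFnn : forall w, 0 <= F beta (phi beta q) w).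
{ intros w; destruct (Req_dec w 0) as [->|N0]; [rewrite F_0; lra|].
  destruct (Req_dec w q) as [->|N1]; [lra|].
  destruct (Req_dec w (- q)) as [->|N2]; [rewrite F_opp; lra|].
  destruct (F_min_cases beta w1 (phi beta q) q w); auto; lra. }
exists Kc; split; [split|split].
- rewrite (K1_eq beta w1); auto.
  apply Rmult_lt_compat_r; [apply Rinv_0_lt_compat; lra|].
  apply (phi_increasing beta w1); auto; lra.
- unfold K2; rewrite Derive_n_c_2; pose proof (ddc_pos beta 0).
  replace (1 / (2 * beta * ddc beta 0)) with (1 / ddc beta 0 / (2 * beta)) by (field; lra).
  apply Rmult_lt_compat_r; [apply Rinv_0_lt_compat; lra|].
  (* If phi(q) were at least 1/c''(0), then phi < phi(q) on all of (0, q), and F would fall strictly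
     from F(0) = 0 to F(q) = 0. *)
  apply Rnot_le_lt; intros Hle.
  cut (F beta (phi beta q) q < F beta (phi beta q) 0); [rewrite F_0; lra|].
  apply F_decreasing; [lra | lra |].
  intros u Hu; destruct (Rle_lt_dec u w1).
  + apply Rlt_le_trans with (2 := Hle); apply (phi_lt_limit_0 beta w1); auto; lra.
  + apply (phi_increasing beta w1); auto; lra.
- intros K HK.
  assert (Hk : 0 < 2 * beta * K) by (repeat apply Rmult_lt_0_compat; lra).
  (* Lowering K below [Kc] strictly raises the quadratic term for w <> 0, and F is already
     nonnegative at [Kc]. *)
  assert (Hpos : forall w, w <> 0 -> 0 < F beta (2 * beta * K) w).
  { intros w Hw0; apply Rle_lt_trans with (1 := HFnn w).
    unfold F; apply Rplus_lt_compat_r, Rmult_lt_compat_l.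
    - assert (w * w <> 0) by now apply Rmult_integral_contrapositive.
      nra.
    - rewrite <- EKc; apply Rinv_lt_contravar; nra. }
  intros x; rewrite (macrostates_iff_F_min beta K 0); [| lra | lra |].
  + rewrite F_0; split; [|intros ->; rewrite Rmult_0_r, F_0; lra].
    intros H; destruct (Req_dec x 0) as [|Hx]; auto.
    assert (2 * beta * K * x <> 0) by (apply Rmult_integral_contrapositive; lra).
    specialize (Hpos (2 * beta * K * x)); lra.
  + intros w; rewrite F_0; destruct (Req_dec w 0) as [->|]; [rewrite F_0; lra|].
    apply Rlt_le; auto.
(* T inverts phi/(2 beta) on [q, oo); its value is meaningful for K >= [Kc]. *)
- set (T K := iota (fun t => q <= t /\ phi beta t / (2 * beta) = K)).
  assert (Hphi : forall s t, q <= s -> s < t -> phi beta s / (2 * beta) < phi beta t / (2 * beta)).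
  { intros s t Hs Hst; apply Rmult_lt_compat_r; [apply Rinv_0_lt_compat; lra|].
    apply (phi_increasing beta w1); auto; lra. }
  assert (HT : forall K, Kc <= K -> q <= T K /\ phi beta (T K) / (2 * beta) = K).
  { intros K HK; apply (iota_correct (fun t => q <= t /\ phi beta t / (2 * beta) = K)).
    destruct (phi_surjective beta q (2 * beta * K)) as [t [Ht Et]]; [lra | |].
    - rewrite <- EKc; apply Rmult_le_compat_l; lra.
    - exists t; split; [split; [auto | rewrite Et; field; lra]|].
      intros t' [Ht' Et'].
      assert (Et2 : phi beta t / (2 * beta) = K) by (rewrite Et; field; lra).
      destruct (Rtotal_order t t') as [H|[H|H]]; auto.
      + pose proof (Hphi t t' Ht H); lra.
      + pose proof (Hphi t' t Ht' H); lra. }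
  assert (HTk : forall K, Kc <= K -> phi beta (T K) = 2 * beta * K).
  { intros K HK; destruct (HT K HK) as [_ E]; rewrite <- E at 2; field; lra. }
  assert (Hz : forall K, Kc <= K -> 2 * beta * K * dc beta (T K) = T K).
  { intros K HK; rewrite <- HTk by auto; destruct (HT K HK) as [H _].
    pose proof (dc_pos beta (T K) ltac:(lra)); unfold phi; field; lra. }
  (* The rescaling x = w/(2 beta K) sends T K to c'(T K), because T K is critical. *)
  assert (Hzx : forall K x, Kc <= K ->
    (2 * beta * K * x = T K <-> x = dc beta (T K)) /\
    (2 * beta * K * x = - T K <-> x = - dc beta (T K))).
  { intros K x HK; pose proof (Hz K HK) as E.
    assert (Hk : 2 * beta * K <> 0) by (repeat apply Rmult_integral_contrapositive_currified; lra).
    split; split.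
    - intros H; apply Rmult_eq_reg_l with (2 := Hk); lra.
    - intros ->; auto.
    - intros H; apply Rmult_eq_reg_l with (2 := Hk); lra.
    - intros ->; lra. }
  assert (HTmono : forall K K', Kc <= K -> K < K' -> T K < T K').
  { intros K K' HK HKK'; destruct (HT K HK) as [H1 E1]; destruct (HT K') as [H2 E2]; [lra|].
    apply Rnot_le_lt; intros [H|H].
    - pose proof (Hphi (T K') (T K) H2 H); lra.
    - rewrite H in E2; lra. }
  assert (ETc : T Kc = q).
  { destruct (HT Kc) as [[H|H] E]; [lra | | auto].
    pose proof (Hphi q (T Kc) ltac:(lra) H); fold Kc in H0; lra. }
  assert (Hcont : continuous_on (fun K => Kc <= K) (fun K => dc beta (T K))).
  { intros K HK.
    apply filterlim_comp with (locally (T K)).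
    - now apply (continuous_on_right_inverse (fun t => phi beta t / (2 * beta)) T q Kc).
    - apply (ex_derive_continuous (dc beta)); eexists; apply is_derive_dc. }
  exists (fun K => dc beta (T K)); split; [|split; [|split; [|split]]].
  + rewrite ETc; split; [apply dc_pos; lra|].
    intros x; destruct (Hzx Kc x (Rle_refl _)) as [H1 H2]; rewrite ETc in H1, H2.
    rewrite <- H1, <- H2.
    rewrite (macrostates_iff_F_min beta Kc 0); auto; rewrite EKc, ?F_0; auto.
    split.
    * intros H; destruct (Req_dec x 0) as [|Nx]; auto.
      assert (phi beta q * x <> 0) by (apply Rmult_integral_contrapositive; lra).
      destruct (Req_dec (phi beta q * x) q) as [|N1]; auto.
      destruct (Req_dec (phi beta q * x) (- q)) as [|N2]; auto.
      destruct (F_min_cases beta w1 (phi beta q) q (phi beta q * x)); auto; lra.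
    * intros [-> | [-> | ->]]; rewrite ?Rmult_0_r, ?F_0, ?F_opp; lra.
  + intros K HK.
    destruct (HT K ltac:(lra)) as [HqT _].
    pose proof (HTmono Kc K ltac:(lra) HK) as HqT'; rewrite ETc in HqT'.
    pose proof (HTk K ltac:(lra)) as Ek.
    (* T K > q, where c - t c'/2 is positive, so the wells lie strictly below F(0) = 0. *)
    assert (Hneg : F beta (2 * beta * K) (T K) < 0).
    { rewrite <- Ek, F_critical by lra; specialize (Eq_pos (T K) HqT'); simpl in Eq_pos; lra. }
    assert (Hmin : forall w, w <> T K -> w <> - T K ->
      F beta (2 * beta * K) (T K) < F beta (2 * beta * K) w).
    { intros w N1 N2; destruct (Req_dec w 0) as [->|N0]; [rewrite F_0; lra|].
      destruct (F_min_cases beta w1 (2 * beta * K) (T K) w); auto; lra. }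
    split; [apply dc_pos; lra|].
    intros x; destruct (Hzx K x ltac:(lra)) as [H1 H2]; rewrite <- H1, <- H2.
    rewrite (macrostates_iff_F_min beta K (T K)); [| lra | lra |].
    * split.
      -- intros H; destruct (Req_dec (2 * beta * K * x) (T K)) as [|N1]; auto.
         destruct (Req_dec (2 * beta * K * x) (- T K)) as [|N2]; auto.
         specialize (Hmin _ N1 N2); lra.
      -- intros [-> | ->]; rewrite ?F_opp; lra.
    * intros w; destruct (Req_dec w (T K)) as [->|N1]; [lra|].
      destruct (Req_dec w (- T K)) as [->|N2]; [rewrite F_opp; lra|].
      apply Rlt_le; auto.
  + intros K K' HK HKK'; apply (is_derive_increasing (dc beta) (ddc beta)); auto.
    * intros u _; apply is_derive_dc.
    * intros u _; apply ddc_pos.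
  + exact Hcont.
  + eapply filterlim_filter_le_1; [|exact (Hcont Kc (Rle_refl _))].
    intros P [d Hd]; exists d; intros y Hy Hlt; apply Hd; [auto | lra].
Qed.
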